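(* Fix a unital commutative ring $R$, an integer $n \geq 1$, and commuting indeterminates $u_i, v_i$ for $i = 1,\dots,n$. Given an element $g \in GL_n(R)$, each of the following assertions implies the next: \begin{enumerate} \item $g$ is a signed permutation matrix: $g \in S_2 \wr S_n$. \item $g^{\mathbf{u}} \cdot F(u_1 v_1, \dots, u_n v_n) = (g^{-1})^{\mathbf{v}} \cdot F(u_1 v_1, \dots, u_n v_n)$ for all symmetric polynomials $F \in R[w_1,\dots,w_n]^{S_n}$. \item $g^{\mathbf{u}} \cdot F(u_1 v_1, \dots, u_n v_n) = (g^{-1})^{\mathbf{v}} \cdot F(u_1 v_1, \dots, u_n v_n)$ for $F$ each of the $n$ elementary symmetric polynomials \[ e_k(\mathbf{w}) = \sum_{1 \leq i_1 < i_2 < \cdots < i_k \leq n} w_{i_1} w_{i_2} \cdots w_{i_k}, \qquad 1 \leq k \leq n. \] \end{enumerate} If moreover $R$ is an integral domain, then all three assertions are equivalent.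
   Context: For $g = (m_{ij})_{i,j=1}^n \in GL_n(R)$, $g^{\mathbf{u}}$ denotes the $R$-algebra automorphism of $R[u_1,\dots,u_n,v_1,\dots,v_n]$ that sends $u_j \mapsto \sum_{i=1}^n m_{ij} u_i$ for each $j$ and fixes every $v_j$. Likewise $g^{\mathbf{v}}$ denotes the $R$-algebra automorphism that sends $v_j \mapsto \sum_{i=1}^n m_{ij} v_i$ and fixes every $u_j$. A signed permutation matrix in $GL_n(R)$ (an element of $S_2 \wr S_n$) is a product $D\sigma$ of a diagonal matrix $D$ with diagonal entries in $\{\pm 1\} \subseteq R$ and a permutation matrix $\sigma$. *)

(* Defs.v *)
From HB Require Import structures.
From mathcomp Require Export all_boot all_fingroup all_algebra.
From mathcomp Require Export mpoly.

Set Implicit Arguments.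
Unset Strict Implicit.
Unset Printing Implicit Defensive.

Import GRing.Theory.
Local Open Scope ring_scope.

(* R[u_1, ..., u_n, v_1, ..., v_n] is {mpoly R[n + n]}: the first n variables
   are the u's and the last n are the v's. *)
Definition uvar (n : nat) (R : comUnitRingType) (i : 'I_n) : {mpoly R[n + n]} :=
  'X_(lshift n i).
Definition vvar (n : nat) (R : comUnitRingType) (i : 'I_n) : {mpoly R[n + n]} :=
  'X_(rshift n i).

Arguments uvar {n} R i.
Arguments vvar {n} R i.

Definition act_u (n : nat) (R : comUnitRingType) (g : 'M[R]_n)
    (p : {mpoly R[n + n]}) : {mpoly R[n + n]} :=
  p \mPo [tuple match split k with
                | inl j => \sum_(i < n) g i j *: uvar R i
                | inr j => vvar R j
                end | k < n + n].

Definition act_v (n : nat) (R : comUnitRingType) (g : 'M[R]_n)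
    (p : {mpoly R[n + n]}) : {mpoly R[n + n]} :=
  p \mPo [tuple match split k with
                | inl j => uvar R j
                | inr j => \sum_(i < n) g i j *: vvar R i
                end | k < n + n].

(* F(u_1 v_1, ..., u_n v_n) *)
Definition subst_uv (n : nat) (R : comUnitRingType) (F : {mpoly R[n]}) :
    {mpoly R[n + n]} :=
  F \mPo [tuple uvar R i * vvar R i | i < n].

Definition signed_perm_mx (n : nat) (R : comUnitRingType) (g : 'M[R]_n) : Prop :=
  exists (d : 'rV[R]_n) (s : {perm 'I_n}),
    (forall i : 'I_n, d 0 i = 1 \/ d 0 i = -1) /\ g = diag_mx d *m perm_mx s.

(* Main.v *)
(** If [g] is a signed permutation matrix then [g^-1 = g^T], and [g^u] and
    [(g^-1)^v] send the tuple [(u_j v_j)_j] to the same tuple up to a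
    permutation of its entries, which a symmetric polynomial does not see.
    Conversely only [e_1] and [e_2] are needed, and only at points where [u] is
    the indicator of one index [a] and [v] that of one or two indices.  For
    [e_1] and [v] the indicator of [b] one gets [g a b = g^-1 b a], so [g] is
    orthogonal.  For [e_2] and [v] the indicator of [{b, c}] the right-hand side
    vanishes, since only one of the [u_j v_j] is nonzero there, and the
    left-hand side is [g a b * g a c].  Over a domain each row of [g] thus has a
    single nonzero entry, of square 1. *)
Require Import Defs.
Import GRing.Theory.
Local Open Scope ring_scope.

(** Substitution is linear and multiplicative, so monomials suffice. This moves an action, itself a
    substitution, inside [F]. *)
Lemma comp_mpolyA (R : comNzRingType) (n k l : nat) (p : {mpoly R[n]})
    (s : n.-tuple {mpoly R[k]}) (t : k.-tuple {mpoly R[l]}) :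
  (p \mPo s) \mPo t = p \mPo [tuple tnth s i \mPo t | i < n].
Proof.
rewrite (comp_mpolyEX p s) (comp_mpolyEX p) raddf_sum; apply: eq_bigr => m _ /=.
rewrite comp_mpolyZ !comp_mpolyX rmorph_prod; congr (_ *: _).
by apply: eq_bigr => i _; rewrite rmorphXn tnth_mktuple.
Qed.

Lemma meval_mesym (R : comNzRingType) (n k : nat) (w : 'I_n -> R) :
  (mesym n R k).@[w] = \sum_(S : {set 'I_n} | #|S| == k) \prod_(i in S) w i.
Proof.
rewrite mesymE raddf_sum; apply: eq_bigr => S _ /=.
rewrite mevalX [RHS]big_mkcond; apply: eq_bigr => i _ /=.
by rewrite mnmE; case: (i \in S).
Qed.

(** A [k]-subset other than [T] cannot lie inside [T], as [#|T| <= k], so its product has a zero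
    factor. Only [T] itself can contribute, and only if it has size [k]. *)
Lemma meval_mesym_supp (R : comNzRingType) (n k : nat) (w : 'I_n -> R)
    (T : {set 'I_n}) :
    (#|T| <= k)%N -> (forall i, i \notin T -> w i = 0) ->
  (mesym n R k).@[w] = \prod_(i in T) w i *+ (#|T| == k).
Proof.
move=> leTk wT; rewrite meval_mesym.
have prod0 (S : {set 'I_n}) : #|S| = k -> S != T -> \prod_(i in S) w i = 0.
  move=> cardS; rewrite eqEcard cardS leTk andbT => /subsetPn[i Si Ti].
  by rewrite (bigD1 i) //= wT ?mul0r.
case: eqP => [cardT | /eqP cardT].
  rewrite (bigD1 T) ?cardT //= [X in _ + X]big1 ?addr0 // => S.
  by case/andP=> /eqP cardS; apply: prod0.
apply: big1 => S /eqP cardS; apply: prod0 => //.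
by apply: contraNneq cardT => <-; rewrite cardS.
Qed.

Section Actions.
Context {R : comUnitRingType} {n : nat}.
Implicit Types (g : 'M[R]_n) (F : {mpoly R[n]}) (x y : 'I_n -> R).

Lemma subst_uv_comp F (t : (n + n).-tuple {mpoly R[n + n]}) :
  subst_uv F \mPo t =
  F \mPo [tuple tnth t (lshift n j) * tnth t (rshift n j) | j < n].
Proof.
rewrite /subst_uv comp_mpolyA; congr (F \mPo _); apply: eq_from_tnth => j.
by rewrite !tnth_mktuple rmorphM /= /uvar /vvar !comp_mpolyXU -!tnth_nth.
Qed.

Lemma act_u_subst_uv g F :
  act_u g (subst_uv F) =
  F \mPo [tuple (\sum_(i < n) g i j *: uvar R i) * vvar R j | j < n].
Proof.
rewrite /act_u subst_uv_comp; congr (F \mPo _); apply: eq_from_tnth => j.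
by rewrite !tnth_mktuple (unsplitK (inl j)) (unsplitK (inr j)).
Qed.

Lemma act_v_subst_uv g F :
  act_v g (subst_uv F) =
  F \mPo [tuple uvar R j * (\sum_(i < n) g i j *: vvar R i) | j < n].
Proof.
rewrite /act_v subst_uv_comp; congr (F \mPo _); apply: eq_from_tnth => j.
by rewrite !tnth_mktuple (unsplitK (inl j)) (unsplitK (inr j)).
Qed.

Definition uv_point x y (k : 'I_(n + n)) : R :=
  match split k with inl i => x i | inr j => y j end.

Lemma meval_uvar x y i : (uvar R i).@[uv_point x y] = x i.
Proof. by rewrite mevalXU /uv_point (unsplitK (inl i)). Qed.

Lemma meval_vvar x y i : (vvar R i).@[uv_point x y] = y i.
Proof. by rewrite mevalXU /uv_point (unsplitK (inr i)). Qed.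

(** Evaluation turns the polynomial identities into equations in [R], from which entries of [g] are
    read off at 0/1 points. *)
Lemma meval_act_u g F x y :
  (act_u g (subst_uv F)).@[uv_point x y] =
  F.@[fun j => (\sum_(i < n) g i j * x i) * y j].
Proof.
rewrite act_u_subst_uv comp_mpoly_meval; apply: meval_eq => j.
rewrite tnth_mktuple mevalM meval_vvar raddf_sum; congr (_ * _).
by apply: eq_bigr => i _ /=; rewrite mevalZ meval_uvar.
Qed.

Lemma meval_act_v g F x y :
  (act_v g (subst_uv F)).@[uv_point x y] =
  F.@[fun j => x j * (\sum_(i < n) g i j * y i)].
Proof.
rewrite act_v_subst_uv comp_mpoly_meval; apply: meval_eq => j.
rewrite tnth_mktuple mevalM meval_uvar raddf_sum; congr (_ * _).
by apply: eq_bigr => i _ /=; rewrite mevalZ meval_vvar.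
Qed.

Lemma sum_mul_indic (f : 'I_n -> R) a : \sum_(i < n) f i * (i == a)%:R = f a.
Proof.
rewrite (bigD1 a) //= eqxx mulr1 big1 ?addr0 // => i /negPf->.
by rewrite mulr0.
Qed.

Lemma diag_perm_mxE (d : 'rV[R]_n) (s : {perm 'I_n}) i j :
  (diag_mx d *m perm_mx s) i j = d 0 i *+ (s i == j).
Proof. by rewrite mul_diag_mx !mxE mulr_natr. Qed.

Lemma signed_perm_act g F :
  signed_perm_mx g -> F \is symmetric ->
  act_u g (subst_uv F) = act_v (invmx g) (subst_uv F).
Proof.
case=> d [s [d1 def_g]] /issymP symF.
have gE i j : g i j = d 0 i *+ (s i == j) by rewrite def_g diag_perm_mxE.
(* Row [i] has its only nonzero entry, of square 1, in column [s i], and [s] is injective. *)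
have gtr : g *m g^T = 1%:M.
  apply/matrixP => i j; rewrite !mxE (bigD1 (s i)) //= big1 => [|k].
    rewrite mxE !gE eqxx (inj_eq perm_inj) eq_sym addr0 mulrnAr.
    by case: eqP => [<-|//]; case: (d1 i) => ->; rewrite ?mulrNN mulr1.
  by rewrite gE eq_sym => /negPf->; rewrite mul0r.
have [g_unit _] := mulmx1_unit gtr.
have invg : invmx g = g^T by rewrite -[RHS](mulKmx g_unit) gtr mulmx1.
(* Only the left [F] is permuted, so its entry at [s j] meets the right entry at [j]: both are
   [d 0 j] times [u_j v_(s j)]. *)
rewrite act_u_subst_uv act_v_subst_uv -{1}(symF s) msym_mPo invg.
congr (F \mPo _); apply: eq_from_tnth => j; rewrite !tnth_mktuple.
rewrite (bigD1 j) //= [in RHS](bigD1 (s j)) //= !big1 => [|i|i].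
- by rewrite mxE gE eqxx !addr0 -scalerAl -scalerAr.
- by rewrite mxE gE eq_sym => /negPf->; rewrite scale0r.
- by rewrite gE (inj_eq perm_inj) => /negPf->; rewrite scale0r.
Qed.

Lemma act_mesym1 g h a b :
    act_u g (subst_uv (mesym n R 1)) = act_v h (subst_uv (mesym n R 1)) ->
  g a b = h b a.
Proof.
move/(congr1 (meval (uv_point (fun i => (i == a)%:R) (fun i => (i == b)%:R)))).
rewrite meval_act_u meval_act_v.
rewrite (meval_mesym_supp _ _ _ _ [set b]) ?cards1 //; last first.
  by move=> i; rewrite inE => /negPf->; rewrite mulr0.
rewrite (meval_mesym_supp _ _ _ _ [set a]) ?cards1 //; last first.
  by move=> i; rewrite inE => /negPf->; rewrite mul0r.
by rewrite !big_set1 !sum_mul_indic !eqxx mulr1 mul1r !mulr1n.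
Qed.

Lemma act_mesym2 g h a b c :
    act_u g (subst_uv (mesym n R 2)) = act_v h (subst_uv (mesym n R 2)) ->
  b != c -> g a b * g a c = 0.
Proof.
move=> eq2 neq_bc; move: eq2.
move/(congr1 (meval (uv_point (fun i => (i == a)%:R)
                              (fun i => (i \in [set b; c])%:R)))).
rewrite meval_act_u meval_act_v.
rewrite (meval_mesym_supp _ _ _ _ [set b; c]) ?cards2 ?neq_bc //; last first.
  by move=> i /negPf->; rewrite mulr0.
(* [[set a]] has size 1, not 2, so the right-hand side becomes a 0-fold multiple. *)
rewrite (meval_mesym_supp _ _ _ _ [set a]) ?cards1 //; last first.
  by move=> i; rewrite inE => /negPf->; rewrite mul0r.
rewrite big_setU1 ?inE //= big_set1 !sum_mul_indic !inE !eqxx orbT.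
by rewrite !mulr1 mulr1n mulr0n.
Qed.

Lemma orthogonal_monomial_signed_perm g :
    GRing.integral_domain_axiom R -> g *m g^T = 1%:M ->
    (forall a b c, b != c -> g a b * g a c = 0) ->
  signed_perm_mx g.
Proof.
move=> domR gtr row0.
have gtrE i j : \sum_k g i k * g j k = (i == j)%:R.
  move/matrixP/(_ i j): gtr; rewrite !mxE => <-.
  by apply: eq_bigr => k _; rewrite mxE.
(* A zero row would make a diagonal entry of [g *m g^T] vanish, whereas it is 1. *)
have nz_row i : {j | g i j != 0}.
  case: (pickP (fun j => g i j != 0)) => [j nz_j | row_i0]; first by exists j.
  have := oner_neq0 R; rewrite -[1]/(true%:R) -(eqxx i) -gtrE.
  by rewrite big1 ?eqxx // => k _; move/eqP: (row_i0 k) => ->; rewrite mul0r.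
pose f i := sval (nz_row i).
have nz_f i : g i (f i) != 0 := svalP (nz_row i).
have g0 i j : j != f i -> g i j = 0.
  move=> neq_j; have /domR/orP[/eqP// | fi0] := row0 i _ _ neq_j.
  by have := nz_f i; rewrite fi0.
(* By [g0], only the column [f i] survives in the product of rows [i] and [j]. *)
have gf i j : g i (f i) * g j (f i) = (i == j)%:R.
  rewrite -gtrE (bigD1 (f i)) //= big1 ?addr0 // => k /g0->.
  by rewrite mul0r.
(* Two distinct rows sharing their nonzero column would have a nonzero product, against
   orthogonality. *)
have inj_f : injective f.
  move=> i j eq_f; apply/eqP; case: eqP => // /eqP/negPf neq_ij.
  have /domR : g i (f i) * g j (f j) = 0 by rewrite -eq_f gf neq_ij.
  by rewrite (negPf (nz_f i)) (negPf (nz_f j)).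
exists (\row_i g i (f i)), (perm inj_f); split=> [i|].
  (* The entry [x] satisfies [x ^+ 2 = 1], so [(x - 1) * (x + 1) = 0] in a domain. *)
  have /eqP := gf i i; rewrite eqxx mxE -subr_eq0 -expr2 subr_sqr_1.
  move=> /eqP/domR/orP[]; first by rewrite subr_eq0 => /eqP; left.
  by rewrite addr_eq0 => /eqP; right.
apply/matrixP => i j; rewrite diag_perm_mxE mxE permE.
by case: eqP => [<- // | /eqP]; rewrite eq_sym => /g0.
Qed.

End Actions.

Theorem theorem2p6 (R : comUnitRingType) (n : nat) (n_ge1 : (1 <= n)%N)
    (g : 'M[R]_n) (g_unit : g \in unitmx) :
  let assertion1 : Prop := signed_perm_mx g in
  let assertion2 : Prop :=
    forall F : {mpoly R[n]}, F \is symmetric ->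
      act_u g (subst_uv F) = act_v (invmx g) (subst_uv F) in
  let assertion3 : Prop :=
    forall k : nat, (1 <= k <= n)%N ->
      act_u g (subst_uv (mesym n R k)) =
      act_v (invmx g) (subst_uv (mesym n R k)) in
  (assertion1 -> assertion2) /\
  (assertion2 -> assertion3) /\
  (GRing.integral_domain_axiom R ->
     (assertion1 <-> assertion2) /\ (assertion2 <-> assertion3)).
Proof.
move=> A1 A2 A3.
have A12 : A1 -> A2 by move=> sg F symF; apply: signed_perm_act.
have A23 : A2 -> A3 by move=> eqF k _; apply/eqF/mesym_sym.
split=> //; split=> // domR.
suff A31 : A3 -> A1 by split; [split=> // /A23/A31 | split=> // /A31/A12].
move=> eq_e; apply: orthogonal_monomial_signed_perm => // [|a b c neq_bc].
  suff -> : g^T = invmx g by rewrite mulmxV.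
  by apply/matrixP => i j; rewrite mxE; apply/act_mesym1/eq_e.
(* Assertion 3 covers [k = 2] only when [2 <= n], which the two distinct indices [b] and [c]
   ensure. *)
apply: (act_mesym2 _ _ _ _ _ (eq_e 2 _) neq_bc).
by have := max_card [set b; c]; rewrite cards2 neq_bc card_ord.
Qed.
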